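(* Let $(\rho,v)$ be any convex integration realization generated by an admissible piecewise constant fan subsolution, and let $(\rho^{\mathrm{ref}},v^{\mathrm{ref}})$ be a piecewise constant self-similar reference solution with the same Riemann data. Then $$\mathcal A(\rho^{\mathrm{ref}},v^{\mathrm{ref}},t)-\mathcal A(\rho,v,t)=\frac{\ell t^2}{2}\,\mathfrak D,\qquad \mathfrak D:=\int_{\mathbb R}\left[\Lambda^{\mathrm{ref}}(\xi)-\Lambda^{\mathrm{fan}}(\xi)\right]d\xi .$$ In particular, the fan has strictly smaller action than the reference solution if and only if $\mathfrak D>0$, and strictly larger action if and only if $\mathfrak D<0$, independently of $\ell>0$ and $t>0$.
   Context: Pressure law: $p$ is a sufficiently smooth function on $(0,\infty)$ with $p'>0$, and the specific internal energy $e$ satisfies $p(\rho)=\rho^2e'(\rho)$. Isentropic Euler equations in two space dimensions: $\partial_t\rho+\mathrm{div}(\rho v)=0$, $\partial_t(\rho v)+\mathrm{div}(\rho v\otimes v)+\nabla p(\rho)=0$. Energy and Lagrangian densities: $H(\rho,v)=\tfrac12\rho|v|^2+\rho e(\rho)$, $\mathcal L(\rho,v)=\tfrac12\rho|v|^2-\rho e(\rho)$. A bounded entropic weak solution is a pair $(\rho,v)\in L^\infty$ with $\rho>0$ a.e. that solves the Euler equations in the sense of distributions and satisfies $\partial_tH+\mathrm{div}((H+p(\rho))v)\le0$ in the sense of distributions. Riemann data: $(\rho_-,v_-)$ for $x_2<0$ and $(\rho_+,v_+)$ for $x_2>0$, with constants $\rho_\pm>0$, $v_\pm\in\mathbb R^2$.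 Admissible piecewise constant fan subsolution: constants $\rho_i>0$, $v_i\in\mathbb R^2$, $u_i$ a trace-free symmetric $2\times2$ real matrix, $C_i>0$ ($i=1,\dots,N$), and speeds $\nu_0<\nu_1<\dots<\nu_N$. Put $P_-=\{t>0,\,x_2<\nu_0t\}$, $P_i=\{t>0,\,\nu_{i-1}t<x_2<\nu_it\}$, $P_+=\{t>0,\,x_2>\nu_Nt\}$, and let $\bar\rho,\bar v,\bar u,\bar C$ be the piecewise constant fields with values $\rho_i,v_i,u_i,C_i$ in $P_i$ and $\rho_\pm,\ v_\pm,\ v_\pm\otimes v_\pm-\tfrac12|v_\pm|^2\mathrm{Id},\ |v_\pm|^2$ in $P_\pm$. One requires $v_i\otimes v_i-u_i<\tfrac{C_i}{2}\mathrm{Id}$ for all $i$; the relaxed equations $\partial_t\bar\rho+\mathrm{div}(\bar\rho\bar v)=0$, $\partial_t(\bar\rho\bar v)+\mathrm{div}(\bar\rho\bar u)+\nabla(p(\bar\rho)+\tfrac12\bar\rho\bar C)=0$ (equivalently, the Rankine–Hugoniot relations at every interface); and the admissibility inequality $\partial_t\bar H+\mathrm{div}((\bar H+p(\bar\rho))\bar v)\le0$ with $\bar H=\tfrac12\bar\rho\bar C+\bar\rho e(\bar\rho)$. A convex integration realization generated by the fan is a bounded entropic weak solution $(\rho,v)$ with the same Riemann data such that $\rho=\bar\rho$ a.e., $v=v_\pm$ in $P_\pm$, and $|v|^2=C_i$ a.e. in $P_i$, $i=1,\dots,N$. A piecewise constant self-similar reference solution is given by a partition $-\infty=\sigma_0<\sigma_1<\dots<\sigma_M=\infty$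 and constants $(\rho_j^{\mathrm{ref}},v_j^{\mathrm{ref}})$, with $(\rho^{\mathrm{ref}},v^{\mathrm{ref}})(x,t)=(\rho^{\mathrm{ref}}_j,v^{\mathrm{ref}}_j)$ whenever $\sigma_{j-1}<x_2/t<\sigma_j$. Profiles in $\xi=x_2/t$: $\Lambda^{\mathrm{ref}}(\xi)=\tfrac12\rho_j^{\mathrm{ref}}|v_j^{\mathrm{ref}}|^2-\rho_j^{\mathrm{ref}}e(\rho_j^{\mathrm{ref}})$ for $\sigma_{j-1}<\xi<\sigma_j$; $\Lambda^{\mathrm{fan}}(\xi)=\tfrac12\rho_iC_i-\rho_ie(\rho_i)$ for $\nu_{i-1}<\xi<\nu_i$, and $\Lambda^{\mathrm{fan}}(\xi)=\tfrac12\rho_\pm|v_\pm|^2-\rho_\pm e(\rho_\pm)$ for $\xi<\nu_0$ (sign $-$), respectively $\xi>\nu_N$ (sign $+$). Since the Riemann data agree, $\Lambda^{\mathrm{fan}}=\Lambda^{\mathrm{ref}}$ for $|\xi|$ large. Action differences are computed on the strip $\Omega_\ell=(\mathbb R/\ell\mathbb Z)\times\mathbb R$, $\ell>0$: $\mathcal A(\rho^{(1)},v^{(1)},t)-\mathcal A(\rho^{(2)},v^{(2)},t)=\int_0^t\int_{\Omega_\ell}[\mathcal L(\rho^{(1)},v^{(1)})-\mathcal L(\rho^{(2)},v^{(2)})]\,dx\,d\tau$. *)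

(* Defs.v *)
From HB Require Import structures.
From mathcomp Require Import all_boot all_order all_algebra.
From mathcomp Require Import all_classical all_reals all_analysis.

Set Implicit Arguments.
Unset Strict Implicit.
Unset Printing Implicit Defensive.

Import Order.TTheory GRing.Theory Num.Theory.
Import numFieldNormedType.Exports.

Local Open Scope classical_set_scope.
Local Open Scope ring_scope.

(* The library's sigma-finite instance for product measures is shadowed by its
   instances for finite measures, so it is re-established for leb2. *)
Definition leb2 (R : realType) := (@lebesgue_measure R \x @lebesgue_measure R)%E.
Arguments leb2 R : clear implicits.

HB.instance Definition _ (R : realType) := Measure.on (leb2 R).

Fact leb2_sigma_finite (R : realType) : sigma_finite setT (leb2 R).
Proof.
have /sigma_finiteP[F [TF ndF Foo]] := sigma_finiteT (@lebesgue_measure R).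
exists (fun n => F n `*` F n).
  rewrite -setXTT TF predeqE => -[x y]; split.
    move=> [/= [n _ Fnx] [k _ Gky]]; exists (maxn n k) => //; split.
    - by move: x Fnx; exact/subsetPset/ndF/leq_maxl.
    - by move: y Gky; exact/subsetPset/ndF/leq_maxr.
  by move=> [n _ []/= ? ?]; split; exists n.
move=> k; have [? ?] := Foo k.
split; first exact: measurableX.
by rewrite /leb2 product_measure1E// lte_mul_pinfty// ge0_fin_numE.
Qed.

HB.instance Definition _ (R : realType) :=
  Measure_isSigmaFinite.Build _ _ _ (leb2 R) (leb2_sigma_finite R).

Definition leb3 (R : realType) := (@lebesgue_measure R \x leb2 R)%E.
Arguments leb3 R : clear implicits.

HB.instance Definition _ (R : realType) := Measure.on (leb3 R).

(* Points are written (x1, x2), and (t, (x1, x2)) in space-time. *)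
Notation plane R := (R * R)%type.
Notation spacetime R := (R * (R * R))%type.

Definition positive_time (R : realType) : set (spacetime R) :=
  [set z | 0 < z.1].
Arguments positive_time R : clear implicits.

(* The library norm on 'rV[R]_n is the sup norm, hence the explicit Euclidean
   dot product. *)
Definition dotv (R : realType) n (v w : 'rV[R]_n) : R :=
  \sum_(j < n) v ord0 j * w ord0 j.

Definition normsq (R : realType) n (v : 'rV[R]_n) : R := dotv v v.

Definition tensor (R : realType) n (v : 'rV[R]_n) : 'M[R]_n := v^T *m v.

(* A < B in the Loewner order: B - A is positive definite. *)
Definition mx_lt (R : realType) n (A B : 'M[R]_n) : Prop :=
  forall x : 'rV[R]_n, x != 0 -> 0 < (x *m (B - A) *m x^T) ord0 ord0.

Definition pressure_law (R : realType) (p e : R -> R) : Prop :=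
  forall r : R, 0 < r ->
    [/\ derivable p r 1, {for r, continuous (derive1 p)}, 0 < derive1 p r,
        derivable e r 1 & p r = r ^+ 2 * derive1 e r].

(* The argument k stands for |v|^2, so that the same formulas serve for
   subsolutions, where |v|^2 is replaced by C. *)
Definition energy (R : realType) (e : R -> R) (r k : R) : R :=
  r * k / 2 + r * e r.

Definition lagrangian (R : realType) (e : R -> R) (r k : R) : R :=
  r * k / 2 - r * e r.

Definition smooth (R : realType) (phi : spacetime R -> R) : Prop :=
  forall ws : seq (spacetime R),
    let psi := foldr (fun w g z => 'D_w g z) phi ws in
    continuous psi /\ (forall z w, derivable psi z w).

Definition supp (R : realType) (phi : spacetime R -> R) : set (spacetime R) :=
  closure [set z | phi z != 0].

Definition test_function (R : realType) (phi : spacetime R -> R) : Prop :=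
  smooth phi /\ compact (supp phi).

Definition dt (R : realType) (phi : spacetime R -> R) (z : spacetime R) : R :=
  'D_((1, (0, 0)) : spacetime R) phi z.

Definition grad (R : realType) (phi : spacetime R -> R) (z : spacetime R) :
    'rV[R]_2 :=
  \row_(j < 2) 'D_(if j == ord0 then (0, (1, 0)) else (0, (0, 1)) : spacetime R)
                 phi z.

(* The integrals below are valued in \bar R, where +oo - +oo is -oo: being
   equal to 0, or being nonnegative and finite, forces the positive and the
   negative part of the integrand to be both integrable. *)
Definition weak_form (R : realType) (U : spacetime R -> R)
    (F : spacetime R -> 'rV[R]_2) (phi : spacetime R -> R) : \bar R :=
  (\int[leb3 R]_(z in positive_time R)
     (U z * dt phi z + dotv (F z) (grad phi z))%R%:E)%E.

(* d_t U + div F = 0 in t > 0 *)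
Definition conserved (R : realType) (U : spacetime R -> R)
    (F : spacetime R -> 'rV[R]_2) : Prop :=
  forall phi, test_function phi -> supp phi `<=` positive_time R ->
    weak_form U F phi = 0%E.

(* d_t U + div F = 0 in t > 0 with initial datum U0. Test functions need not
   vanish at t = 0. *)
Definition conserved_from (R : realType) (U0 : plane R -> R)
    (U : spacetime R -> R) (F : spacetime R -> 'rV[R]_2) : Prop :=
  forall phi, test_function phi ->
    (weak_form U F phi + \int[leb2 R]_x (U0 x * phi (0, x))%R%:E = 0)%E.

(* d_t U + div F <= 0 in t > 0 *)
Definition dissipated (R : realType) (U : spacetime R -> R)
    (F : spacetime R -> 'rV[R]_2) : Prop :=
  forall phi, test_function phi -> supp phi `<=` positive_time R ->
    (forall z, 0 <= phi z) -> (0 <= weak_form U F phi < +oo)%E.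

Record riemann_data (R : realType) := RiemannData {
  rho_minus : R; v_minus : 'rV[R]_2;
  rho_plus : R; v_plus : 'rV[R]_2 }.

Definition rho_init (R : realType) (d : riemann_data R) (x : plane R) : R :=
  if x.2 < 0 then rho_minus d else rho_plus d.

Definition v_init (R : realType) (d : riemann_data R) (x : plane R) : 'rV[R]_2 :=
  if x.2 < 0 then v_minus d else v_plus d.

Definition essentially_bounded (R : realType) (f : spacetime R -> R) : Prop :=
  f \_ (positive_time R) \in Lfun (leb3 R) +oo%E.

(* The flux of the k-th momentum component is the k-th row of the flux tensor. *)
Definition euler_solution (R : realType) (p : R -> R) (d : riemann_data R)
    (rho : spacetime R -> R) (v : spacetime R -> 'rV[R]_2) : Prop :=
  conserved_from (rho_init d) rho (fun z => rho z *: v z) /\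
  forall k : 'I_2,
    conserved_from (fun x => rho_init d x * v_init d x ord0 k)
      (fun z => rho z * v z ord0 k)
      (fun z => row k (rho z *: tensor (v z) + (p (rho z))%:M)).

Record bounded_entropic_solution (R : realType) (p e : R -> R)
    (d : riemann_data R) (rho : spacetime R -> R)
    (v : spacetime R -> 'rV[R]_2) : Prop := BoundedEntropicSolution {
  bes_rho_bounded : essentially_bounded rho;
  bes_v_bounded : forall k, essentially_bounded (fun z => v z ord0 k);
  bes_rho_gt0 : {ae leb3 R, forall z, positive_time R z -> 0 < rho z};
  bes_euler : euler_solution p d rho v;
  bes_entropy :
    let H z := energy e (rho z) (normsq (v z)) in
    dissipated H (fun z => (H z + p (rho z)) *: v z) }.

(* The speeds are nu_0, ..., nu_N; the i-th region lies between nu_i and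
   nu_(i+1), with i = 0, ..., N - 1. *)
Record fan (R : realType) (N : nat) := Fan {
  nu : 'I_N.+1 -> R;
  fan_rho : 'I_N -> R;
  fan_v : 'I_N -> 'rV[R]_2;
  fan_u : 'I_N -> 'M[R]_2;
  fan_C : 'I_N -> R }.

Definition P_minus (R : realType) N (F : fan R N) : set (spacetime R) :=
  [set z | 0 < z.1 /\ z.2.2 < nu F ord0 * z.1].

Definition P_mid (R : realType) N (F : fan R N) (i : 'I_N) : set (spacetime R) :=
  [set z | 0 < z.1 /\ nu F (inord i) * z.1 < z.2.2 < nu F (inord i.+1) * z.1].

Definition P_plus (R : realType) N (F : fan R N) : set (spacetime R) :=
  [set z | 0 < z.1 /\ nu F ord_max * z.1 < z.2.2].

(* The piecewise constant function of xi = x2 / t with value am, a i, ap in the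
   minus, i-th and plus region. Its values at the speeds nu_i are irrelevant. *)
Definition fan_profile (R : realType) N (F : fan R N) (T : Type) (am : T)
    (a : 'I_N -> T) (ap : T) (xi : R) : T :=
  if xi < nu F ord0 then am
  else if nu F ord_max < xi then ap
  else if [pick i : 'I_N | nu F (inord i) < xi < nu F (inord i.+1)] is Some i
  then a i else am.

Definition fan_field (R : realType) N (F : fan R N) (T : Type) (am : T)
    (a : 'I_N -> T) (ap : T) (z : spacetime R) : T :=
  fan_profile F am a ap (z.2.2 / z.1).

Section fan_fields.
Context (R : realType) (e : R -> R) (d : riemann_data R) (N : nat) (F : fan R N).

Definition rho_bar : spacetime R -> R :=
  fan_field F (rho_minus d) (fan_rho F) (rho_plus d).

Definition v_bar : spacetime R -> 'rV[R]_2 :=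
  fan_field F (v_minus d) (fan_v F) (v_plus d).

Definition deviator (w : 'rV[R]_2) : 'M[R]_2 := tensor w - (normsq w / 2)%:M.

Definition u_bar : spacetime R -> 'M[R]_2 :=
  fan_field F (deviator (v_minus d)) (fan_u F) (deviator (v_plus d)).

Definition C_bar : spacetime R -> R :=
  fan_field F (normsq (v_minus d)) (fan_C F) (normsq (v_plus d)).

Definition Lambda_fan : R -> R :=
  fan_profile F (lagrangian e (rho_minus d) (normsq (v_minus d)))
    (fun i => lagrangian e (fan_rho F i) (fan_C F i))
    (lagrangian e (rho_plus d) (normsq (v_plus d))).

End fan_fields.

Record admissible_fan_subsolution (R : realType) (p e : R -> R)
    (d : riemann_data R) N (F : fan R N) : Prop := AdmissibleFanSubsolution {
  fan_nu_lt : forall i j : 'I_N.+1, (i < j)%N -> nu F i < nu F j;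
  fan_rho_gt0 : forall i, 0 < fan_rho F i;
  fan_C_gt0 : forall i, 0 < fan_C F i;
  fan_u_sym : forall i, (fan_u F i)^T = fan_u F i;
  fan_u_tr0 : forall i, \tr (fan_u F i) = 0;
  fan_subsolution :
    forall i, mx_lt (tensor (fan_v F i) - fan_u F i) (fan_C F i / 2)%:M;
  fan_mass : conserved (rho_bar d F) (fun z => rho_bar d F z *: v_bar d F z);
  fan_momentum : forall k : 'I_2,
    conserved (fun z => rho_bar d F z * v_bar d F z ord0 k)
      (fun z => row k (rho_bar d F z *: u_bar d F z
        + (p (rho_bar d F z) + rho_bar d F z * C_bar d F z / 2)%:M));
  fan_entropy :
    let H z := energy e (rho_bar d F z) (C_bar d F z) in
    dissipated H (fun z => (H z + p (rho_bar d F z)) *: v_bar d F z) }.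

Record convex_integration_realization (R : realType) (p e : R -> R)
    (d : riemann_data R) N (F : fan R N) (rho : spacetime R -> R)
    (v : spacetime R -> 'rV[R]_2) : Prop := ConvexIntegrationRealization {
  cir_solution : bounded_entropic_solution p e d rho v;
  cir_rho : {ae leb3 R, forall z, positive_time R z -> rho z = rho_bar d F z};
  cir_v_minus : {ae leb3 R, forall z, P_minus F z -> v z = v_minus d};
  cir_v_plus : {ae leb3 R, forall z, P_plus F z -> v z = v_plus d};
  cir_v_mid : forall i,
    {ae leb3 R, forall z, P_mid F i z -> normsq (v z) = fan_C F i} }.

(* There are M.+1 constant states, separated by
   -oo = sigma_0 < ... < sigma_(M+1) = +oo. *)
Record selfsimilar (R : realType) (M : nat) := Selfsimilar {
  sigma : 'I_M.+2 -> \bar R;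
  ref_state_rho : 'I_M.+1 -> R;
  ref_state_v : 'I_M.+1 -> 'rV[R]_2 }.

(* The values at the finite sigma_j are irrelevant. *)
Definition ref_profile (R : realType) M (S : selfsimilar R M) (T : Type)
    (a : 'I_M.+1 -> T) (xi : R) : T :=
  if [pick j : 'I_M.+1 | (sigma S (inord j) < xi%:E < sigma S (inord j.+1))%E]
    is Some j then a j else a ord0.

Section reference_fields.
Context (R : realType) (e : R -> R) (M : nat) (S : selfsimilar R M).

Definition rho_ref (z : spacetime R) : R :=
  ref_profile S (ref_state_rho S) (z.2.2 / z.1).

Definition v_ref (z : spacetime R) : 'rV[R]_2 :=
  ref_profile S (ref_state_v S) (z.2.2 / z.1).

Definition Lambda_ref : R -> R :=
  ref_profile S
    (fun j => lagrangian e (ref_state_rho S j) (normsq (ref_state_v S j))).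

End reference_fields.

Record reference_solution (R : realType) (p : R -> R) (d : riemann_data R) M
    (S : selfsimilar R M) : Prop := ReferenceSolution {
  ref_sigma_first : sigma S ord0 = -oo%E;
  ref_sigma_last : sigma S ord_max = +oo%E;
  ref_sigma_lt : forall i j : 'I_M.+2, (i < j)%N -> (sigma S i < sigma S j)%E;
  ref_rho_gt0 : forall j, 0 < ref_state_rho S j;
  ref_minus : ref_state_rho S ord0 = rho_minus d /\
              ref_state_v S ord0 = v_minus d;
  ref_plus : ref_state_rho S ord_max = rho_plus d /\
             ref_state_v S ord_max = v_plus d;
  ref_euler : euler_solution p d (rho_ref S) (v_ref S) }.

(* Difference of the actions up to time t of the pairs (rho1, v1) and
   (rho2, v2) over the strip (R / l Z) * R, the circle R / l Z being
   represented by [0, l[. *)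
Definition action_difference (R : realType) (e : R -> R) (l : R)
    (rho1 : spacetime R -> R) (v1 : spacetime R -> 'rV[R]_2)
    (rho2 : spacetime R -> R) (v2 : spacetime R -> 'rV[R]_2) (t : R) : \bar R :=
  (\int[@lebesgue_measure R]_(s in `[0%R, t])
     \int[leb2 R]_(x in `[0%R, l[ `*` setT)
       (lagrangian e (rho1 (s, x)) (normsq (v1 (s, x))) -
        lagrangian e (rho2 (s, x)) (normsq (v2 (s, x))))%R%:E)%E.

Definition action_gap (R : realType) (e : R -> R) (d : riemann_data R)
    N (F : fan R N) M (S : selfsimilar R M) : R :=
  \int[@lebesgue_measure R]_xi (Lambda_ref e S xi - Lambda_fan e d F xi).

(* Main.v *)
Require Import Defs.
From HB Require Import structures.
From mathcomp Require Import all_boot all_order all_algebra.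
From mathcomp Require Import all_classical all_reals all_analysis.
From mathcomp Require Import measurable_realfun.

Set Implicit Arguments.
Unset Strict Implicit.
Unset Printing Implicit Defensive.

Import Order.TTheory GRing.Theory Num.Theory.
Import numFieldNormedType.Exports.

Local Open Scope classical_set_scope.
Local Open Scope ring_scope.

(** The Lagrangian densities of both solutions are functions of xi = x2 / t
    alone. For the reference solution this is its definition. A convex integration
    realization oscillates wildly, but the Lagrangian density sees the velocity
    only through |v|^2, which the realization takes from the fan: |v_-|^2 and
    |v_+|^2 in the outer sectors, C_i in the i-th one. Since its density is that
    of the fan as well, its Lagrangian density is Lambda_fan (x2 / t) almost
    everywhere ([ae_lagrangian_realization]).

    At a fixed time s, the difference of the Lagrangian densities is therefore
    g (x2 / s) with g = Lambda_ref - Lambda_fan. The map x |-> x2 / s sends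
    the Lebesgue measure of the strip [0, l[ * R to l * s times the Lebesgue
    measure of the line, so the spatial integral is l * s times the integral
    of g ([integral_strip]). The profile g is a bounded step function that
    vanishes outside a bounded interval because the Riemann data agree, hence
    it is integrable ([integrable_Lambda_gap]). Integrating l * s over [0, t]
    yields the factor l * t^2 / 2, which is positive, so that the sign of the
    action difference is that of the gap.

    Two points of measure theory need care. The realization agrees with the fan
    almost everywhere in space-time, whereas the action is an iterated
    integral: null sets of a product have null slices at almost every time
    ([ae_product_slice]). Moreover the internal energy e is arbitrary on
    nonpositive arguments, which the density may take on a null set, so the
    integrand need not be measurable; the integral is nevertheless insensitive
    to modifications on null sets ([eq_integral_ae]). *)

(** * Almost everywhere equality and slices *)

Section integral_ae.
Local Open Scope ereal_scope.
Context d (T : measurableType d) (R : realType).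
Variable mu : {measure set T -> \bar R}.

Import HBNNSimple.

(** The integral of a nonnegative function, measurable or not, is the supremum
    of the integrals of the simple functions below it. Cutting such a simple
    function off on a null set does not change its integral. *)
Lemma ge0_le_integral_ae (f g : T -> \bar R) :
  (forall x, 0 <= f x) -> (forall x, 0 <= g x) ->
  {ae mu, forall x, f x <= g x} -> \int[mu]_x f x <= \int[mu]_x g x.
Proof.
move=> f0 g0 [A [mA A0 fgA]].
rewrite !ge0_integralTE//; apply: ge_ereal_sup => _ [h /= hf <-].
have mCA : measurable (~` A) by exact: measurableC.
have projE x : proj_nnsfun h mCA x = (h \_ (~` A)) x by rewrite (mrestrict h mCA).
apply: ereal_sup_ubound; exists (proj_nnsfun h mCA).
  move=> x; rewrite projE /patch; case: ifPn => [|_]; last exact: g0.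
  rewrite inE /= => nAx; rewrite (le_trans (hf x))//.
  by apply: contrapT => nfg; apply/nAx/fgA.
have hE (k : {nnsfun T >-> R}) : sintegral mu k = \int[mu]_x (k x)%:E.
  by rewrite integral_nnsfun// patch_setT.
rewrite !hE; apply: ae_eq_integral => //.
- exact/measurable_EFinP.
- exact/measurable_EFinP.
exists A; split => // x /=; apply: contra_notP => nAx _.
by congr (_%:E); apply: etrans (projE x) _; rewrite /patch mem_set.
Qed.

(** Unlike [ae_eq_integral], this covers functions that are not measurable,
    such as the composition of the internal energy with a density that may take
    nonpositive values on a null set. *)
Lemma eq_integral_ae (D : set T) (f g : T -> \bar R) :
  {ae mu, forall x, D x -> f x = g x} ->
  \int[mu]_(x in D) f x = \int[mu]_(x in D) g x.
Proof.
move=> fg; rewrite integral_mkcond [RHS]integral_mkcond.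
have {}fg : {ae mu, forall x, (f \_ D) x = (g \_ D) x}.
  apply: filterS fg => x fg; rewrite /patch; case: ifPn => // xD.
  by apply: fg; rewrite -inE.
rewrite [LHS]integralE [RHS]integralE; congr (_ - _); apply/eqP; rewrite eq_le;
  by apply/andP; split; apply: ge0_le_integral_ae => //;
     apply: filterS fg => x; rewrite ?funeposE ?funenegE => ->.
Qed.

End integral_ae.

(** The product measure of a set is the integral of the measures of its slices,
    so the slices of a null set are null at almost every point. *)
Lemma ae_product_slice d1 d2 (T1 : measurableType d1) (T2 : measurableType d2)
    (R : realType) (m1 : {measure set T1 -> \bar R})
    (m2 : {sigma_finite_measure set T2 -> \bar R}) (P : T1 * T2 -> Prop) :
  {ae (m1 \x m2)%E, forall z, P z} ->
  {ae m1, forall x, {ae m2, forall y, P (x, y)}}.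
Proof.
move=> [A [mA A0 PA]].
have : ae_eq m1 setT (m2 \o xsection A) (cst 0%E).
  apply/ae_eq_integral_abs => //; first exact: measurable_fun_xsection.
  rewrite -[RHS]A0; apply: eq_integral => x _.
  by rewrite /= gee0_abs.
apply: filterS => x /(_ I) /= Ax0; exists (xsection A x); split => //.
  exact: measurable_xsection.
by move=> y /= nP; apply/mem_set/PA.
Qed.

(** * Measurability of step functions *)

(** The fibres of the vector of all test results form a finite measurable
    partition, and the function is constant on each of them. *)
Lemma measurable_fun_finite_tests d (T : measurableType d) (R : realType)
    (I : finType) (P : I -> T -> bool) (h : {ffun I -> bool} -> R) :
  (forall i, measurable [set x | P i x]) ->
  measurable_fun setT (fun x => h [ffun i => P i x]).
Proof.
move=> mP _ Y mY; rewrite setTI.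
rewrite [X in measurable X](_ : _ = \bigcup_(w in [set w | Y (h w)])
    \bigcap_(i in setT) [set x | P i x = w i]).
  apply: fin_bigcup_measurable => [|w _]; first exact: finite_finset.
  apply: fin_bigcap_measurable => [|i _]; first exact: finite_finset.
  case: (w i); first exact: mP.
  rewrite [X in measurable X](_ : _ = ~` [set x | P i x]).
    exact/measurableC/mP.
  by apply/seteqP; split => x /=; [move=> ->|move/negP/negbTE].
apply/seteqP; split => x /=.
  by move=> Yx; exists [ffun i => P i x] => // i _ /=; rewrite ffunE.
move=> [w Yw wP]; rewrite (_ : [ffun i => P i x] = w)//.
by apply/ffunP => i; rewrite ffunE wP.
Qed.

Lemma measurable_fun_pick (R : realType) n (a b : 'I_n -> \bar R)
    (h : 'I_n -> R) (h0 : R) :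
  measurable_fun [set: R] (fun xi : R =>
    if [pick i | (a i < xi%:E < b i)%E] is Some i then h i else h0).
Proof.
have := @measurable_fun_finite_tests _ R R 'I_n
  (fun i (xi : R) => (a i < xi%:E < b i)%E)
  (fun w => if [pick i | w i] is Some i then h i else h0).
under eq_fun => xi do under eq_pick => i do rewrite ffunE.
apply => i.
rewrite [X in measurable X](_ : _ =
  [set x : R | (a i < x%:E)%E] `&` [set x : R | (x%:E < b i)%E]).
  apply: measurableI.
    by rewrite -[X in measurable X]setTI; exact: measurable_lte.
  by rewrite -[X in measurable X]setTI; exact: measurable_lte.
by apply/seteqP; split => x /= => [/andP[]//|[-> ->]].
Qed.

(** * Self-similar integrals over the strip *)

Section strip.
Context (R : realType).
Local Notation mu := (@lebesgue_measure R).

Lemma measurable_divr (s : R) : measurable_fun [set: R] (fun y : R => y / s).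
Proof. by apply: measurable_funM. Qed.

(** The measure A |-> s^-1 * mu (s A) agrees with the Lebesgue measure on
    intervals, hence everywhere. *)
Lemma lebesgue_measure_scale (s : R) (A : set R) : 0 < s -> measurable A ->
  mu ((fun y => y / s) @^-1` A) = (s%:E * mu A)%E.
Proof.
move=> s0 mA.
have si0 : 0 <= s^-1 by rewrite invr_ge0 ltW.
pose c := NngNum si0.
have mdiv : measurable_fun setT
    (fun y : measurableTypeR R => y / s : measurableTypeR R).
  exact: measurable_divr.
have /(_ mdiv) mu_unique := @lebesgue_measure_unique R (mscale c (pushforward mu
  (fun y : measurableTypeR R => y / s : measurableTypeR R))).
rewrite (mu_unique _ A)//; last first.
  move=> _ [[a b]] _ <-.
  transitivity (s^-1%:E * mu `](a * s)%R, (b * s)%R]%classic)%E; last first.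
    congr (_ * mu _)%E; apply/seteqP; split => y /=;
      by rewrite !in_itv /= ltr_pdivlMr// ler_pdivrMr.
  rewrite !lebesgue_measure_itv /= !lte_fin ltr_pM2r//.
  case: ifPn => ab; last by rewrite mule0.
  by rewrite -!EFinB -EFinM -mulrBl mulrCA mulVf ?gt_eqF// mulr1.
by rewrite /mscale /pushforward /= muleA -EFinM mulfV ?gt_eqF// mul1e.
Qed.

Lemma measurable_strip (l : R) : measurable (`[0, l[ `*` [set: R]).
Proof. exact: measurableX. Qed.

Lemma measurable_similarity (s : R) :
  measurable_fun [set: measurableTypeR R * measurableTypeR R]
    (fun x : measurableTypeR R * measurableTypeR R => x.2 / s : measurableTypeR R).
Proof. by apply: measurable_funM. Qed.

Lemma leb2_strip_preimage (l s : R) (A : set R) : 0 < l -> 0 < s ->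
  measurable A ->
  leb2 R ((fun x : plane R => x.2 / s) @^-1` A `&` `[0, l[ `*` setT)
  = ((l * s)%:E * mu A)%E.
Proof.
move=> l0 s0 mA.
rewrite (_ : _ `&` _ = `[0, l[ `*` ((fun y => y / s) @^-1` A)); last first.
  by apply/seteqP; split => -[x y] /= [? ?]; intuition.
have mdA : measurable ((fun y : R => y / s) @^-1` A).
  by rewrite -[X in measurable X]setTI; exact: measurable_divr.
rewrite /leb2 product_measure1E//.
transitivity (mu `[0%R, l[%classic * mu ((fun y => (y / s)%R) @^-1` A))%E => //.
rewrite lebesgue_measure_itv /= lte_fin l0 oppr0 adde0.
by rewrite EFinM -muleA lebesgue_measure_scale.
Qed.

(** Change of variables y = x2 / s: by [leb2_strip_preimage], the image of the
    measure of the strip is l * s times the Lebesgue measure. *)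
Lemma ge0_integral_strip (l s : R) (g : R -> \bar R) : 0 < l -> 0 < s ->
  measurable_fun setT g -> (forall y, 0 <= g y)%E ->
  (\int[leb2 R]_(x in `[0%R, l[ `*` setT) g (x.2 / s)%R
   = (l * s)%:E * \int[mu]_y g y)%E.
Proof.
move=> l0 s0 mg g0.
pose mS := measurable_strip l.
pose mphi := measurable_similarity s.
have ls0 : 0 <= l * s by rewrite mulr_ge0 ?ltW.
transitivity (\int[mrestr (leb2 R) mS]_x (g (x.2 / s)%R))%E.
  rewrite (eq_measure_integral (mrestr (leb2 R) mS)); last first.
    by move=> A mA AS; rewrite /= /mrestr setIidl.
  (* the restricted measure does not charge the complement of the strip *)
  rewrite integral_mkcond; apply: eq_integral_ae.
  exists (~` (`[0, l[ `*` setT)); split.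
  - exact: measurableC.
  - by rewrite /= /mrestr setICl measure0.
  - by move=> x /= + Sx; apply => _; rewrite /patch mem_set.
rewrite -[LHS](ge0_integral_pushforward mphi _ measurableT); last 2 first.
- exact: mg.
- by move=> y _; exact: g0.
rewrite -(ge0_integral_mscale mu measurableT (NngNum ls0))//.
apply: eq_measure_integral => A mA _.
by rewrite /= /pushforward /mrestr /mscale /= leb2_strip_preimage.
Qed.

Lemma integral_strip (l s : R) (g : R -> R) : 0 < l -> 0 < s ->
  mu.-integrable setT (EFin \o g) ->
  (\int[leb2 R]_(x in `[0%R, l[ `*` setT) (g (x.2 / s))%:E
   = (l * s * \int[mu]_y g y)%:E)%E.
Proof.
move=> l0 s0 ig.
have mg : measurable_fun setT (EFin \o g) := measurable_int _ ig.
rewrite EFinM /Rintegral fineK; last exact: integrable_fin_num.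
rewrite [LHS]integralE [X in _ = (_ * X)%E]integralE muleBr//; last first.
  exact: integrable_add_def.
have mgp : measurable_fun setT (EFin \o g)^\+%E by exact: measurable_funepos.
have mgn : measurable_fun setT (EFin \o g)^\-%E by exact: measurable_funeneg.
rewrite -!ge0_integral_strip//.
by congr (_ - _)%E; apply: eq_integral => x _; rewrite ?funeposE ?funenegE.
Qed.

Lemma integral_linear (c t : R) : 0 < t ->
  (\int[mu]_(s in `[0%R, t]) (c * s)%:E = (c * t ^+ 2 / 2)%:E)%E.
Proof.
move=> t0; pose F (x : R) : R := c / 2 * x ^+ 2.
have dF (x : R) : is_derive x 1 F (c * x).
  have -> : F = (c / 2) *: (@GRing.exp R ^~ 2) by apply/funext.
  apply: is_derive_eq.
  by rewrite -[LHS]/(c / 2 * (x * 1 + x * 1)) !mulr1 -mulr2n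
    -[x *+ 2]mulr_natl mulrA divfK.
have cF : continuous F.
  by move=> x; apply/differentiable_continuous/derivable1_diffP; have [] := dF x.
rewrite (@continuous_FTC2 _ _ F)//.
- by rewrite /F expr0n mulr0 sube0 mulrAC.
- by apply: continuous_subspaceT => x; apply: cvgM; [exact: cvg_cst|exact: cvg_id].
- split; first by move=> x _; have [] := dF x.
    exact/cvg_at_right_filter/cF.
  exact/cvg_at_left_filter/cF.
- by move=> x _; rewrite derive1E; have [] := dF x.
Qed.
End strip.

(** * Profiles of the fan and of the reference solution *)

Lemma le_norm_sum (R : realType) (I : finType) (a : I -> R) (i : I) :
  `|a i| <= \sum_j `|a j|.
Proof. by rewrite (bigD1 i)//= lerDl sumr_ge0. Qed.

Section fan_profile.
Context (R : realType) (N : nat) (F : fan R N).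

Lemma measurable_fan_profile (am : R) (a : 'I_N -> R) (ap : R) :
  measurable_fun [set: R] (fan_profile F am a ap).
Proof.
apply: measurable_fun_ifT => //; first exact: measurable_fun_ltr.
apply: measurable_fun_ifT => //; first exact: measurable_fun_ltr.
exact: (measurable_fun_pick (fun i : 'I_N => (nu F (inord i))%:E)
  (fun i : 'I_N => (nu F (inord i.+1))%:E)).
Qed.

Lemma fan_profile_bounded (am : R) (a : 'I_N -> R) (ap : R) :
  exists K, forall xi, `|fan_profile F am a ap xi| <= K.
Proof.
exists (`|am| + \sum_i `|a i| + `|ap|) => xi; rewrite /fan_profile.
have s0 : 0 <= \sum_i `|a i| by rewrite sumr_ge0.
case: ifP => _; first by rewrite -addrA lerDl addr_ge0.
case: ifP => _; first by rewrite lerDr addr_ge0.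
case: pickP => [i _|_]; last by rewrite -addrA lerDl addr_ge0.
by rewrite (le_trans (le_norm_sum a i))// addrAC lerDr addr_ge0.
Qed.

Lemma fan_profile_right (T : Type) (am : T) (a : 'I_N -> T) (ap : T) xi :
  nu F ord0 <= nu F ord_max -> nu F ord_max < xi ->
  fan_profile F am a ap xi = ap.
Proof.
by move=> nu0N nuxi; rewrite /fan_profile nuxi ltNge (ltW (le_lt_trans nu0N _)).
Qed.

(** The right end of the cell containing xi is the first speed above xi. *)
Lemma fan_cell (xi : R) : nu F ord0 <= xi <= nu F ord_max ->
  (forall k, xi <> nu F k) ->
  exists i : 'I_N, nu F (inord i) < xi < nu F (inord i.+1).
Proof.
move=> /andP[xi0 xiN] xinu.
have exk : exists k, (k <= N)%N && (xi < nu F (inord k)).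
  exists N; rewrite leqnn /=.
  have -> : inord N = ord_max :> 'I_N.+1 by apply/val_inj; rewrite /= inordK.
  by rewrite lt_neqAle xiN andbT; apply/eqP.
case: (ex_minnP exk) => -[|k] /andP[kN xik] kmin.
  have E : inord 0 = ord0 :> 'I_N.+1 by apply/val_inj; rewrite /= inordK.
  by move: xik; rewrite E ltNge xi0.
exists (Ordinal kN); rewrite xik andbT lt_neqAle; apply/andP; split.
  by rewrite eq_sym; apply/eqP.
rewrite leNgt; apply/negP => xik'.
by have := kmin k; rewrite xik' (ltnW kN) ltnn => /(_ isT).
Qed.

End fan_profile.

Section ref_profile.
Context (R : realType) (M : nat) (S : selfsimilar R M).

Lemma measurable_ref_profile (a : 'I_M.+1 -> R) :
  measurable_fun [set: R] (ref_profile S a).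
Proof.
exact: (measurable_fun_pick (fun j : 'I_M.+1 => sigma S (inord j))
  (fun j : 'I_M.+1 => sigma S (inord j.+1))).
Qed.

Lemma ref_profile_bounded (a : 'I_M.+1 -> R) :
  exists K, forall xi, `|ref_profile S a xi| <= K.
Proof.
exists (\sum_j `|a j|) => xi; rewrite /ref_profile.
by case: pickP => [j _|_]; exact: le_norm_sum.
Qed.

Hypothesis sigma_lt : forall i j : 'I_M.+2, (i < j)%N -> (sigma S i < sigma S j)%E.

Lemma sigma_le (m n : nat) : (m <= n)%N -> (n < M.+2)%N ->
  (sigma S (inord m) <= sigma S (inord n))%E.
Proof.
rewrite leq_eqVlt => /predU1P[->//|mn] nM; apply/ltW/sigma_lt.
by rewrite !inordK// (ltn_trans mn).
Qed.

(** Any real A at or below sigma_1 works; sigma_1 itself is +oo when there is a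
    single state. *)
Lemma ref_profile_left (T : Type) (a : 'I_M.+1 -> T) :
  sigma S ord0 = -oo%E ->
  exists A : R, forall xi, xi < A -> ref_profile S a xi = a ord0.
Proof.
move=> s0.
have E : inord 0 = ord0 :> 'I_M.+2 by apply/val_inj; rewrite /= inordK.
have [A As1] : exists A : R, (A%:E <= sigma S (inord 1))%E.
  have : (sigma S ord0 < sigma S (inord 1))%E by apply: sigma_lt; rewrite inordK.
  by rewrite s0; case: (sigma S _) => [r|_|]//; [exists r|exists 0; exact: leey].
exists A => xi xiA; rewrite /ref_profile; case: pickP => [j|].
  case: (posnP j) => [j0 _|j0 /andP[sj _]]; first by congr a; apply/val_inj.
  have := le_lt_trans (sigma_le j0 (ltn_trans (ltn_ord j) (ltnSn _))) sj.
  by rewrite ltNge (le_trans _ As1)// lee_fin ltW.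
move=> /(_ ord0) /negbT /negP[]; rewrite E s0 ltNyr /=.
by rewrite (lt_le_trans _ As1)// lte_fin.
Qed.

Lemma ref_profile_right (T : Type) (a : 'I_M.+1 -> T) :
  sigma S ord_max = +oo%E ->
  exists B : R, forall xi, B < xi -> ref_profile S a xi = a ord_max.
Proof.
move=> sM.
have E : inord M.+1 = ord_max :> 'I_M.+2 by apply/val_inj; rewrite /= inordK.
have [B sB] : exists B : R, (sigma S (inord M) <= B%:E)%E.
  have : (sigma S (inord M) < sigma S ord_max)%E.
    by apply: sigma_lt; rewrite inordK//= ltnW.
  by rewrite sM; case: (sigma S _) => [r||_]//; [exists r|exists 0; exact: leNye].
exists B => xi xiB; rewrite /ref_profile; case: pickP => [j|].
  case: (ltnP j M) => [jM /andP[_ sj]|Mj _]; last first.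
    by congr a; apply/val_inj/anti_leq; rewrite /= Mj -ltnS ltn_ord.
  have := lt_le_trans sj (sigma_le jM (ltnW (ltnSn _))).
  by rewrite ltNge (le_trans sB)// lee_fin ltW.
move=> /(_ ord_max) /negbT /negP[]; rewrite /= E sM ltry andbT.
by rewrite (le_lt_trans sB)// lte_fin.
Qed.

End ref_profile.

Lemma compact_support_integrable (R : realType) (g : R -> R) (a b K : R) :
  measurable_fun [set: R] g -> (forall x, `|g x| <= K) ->
  (forall x, x < a -> g x = 0) -> (forall x, b < x -> g x = 0) ->
  (@lebesgue_measure R).-integrable setT (EFin \o g).
Proof.
move=> mg gK ga gb.
have -> : EFin \o g = (EFin \o g) \_ `[a, b].
  apply/funext => x; rewrite /patch; case: ifPn => //.
  rewrite notin_setE /= in_itv /= => /negP.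
  by rewrite negb_and -!ltNge => /orP[/ga|/gb] /= ->.
apply/(integrable_restrict _ _ _ _).1 => //; rewrite setTI.
apply: measurable_bounded_integrable => //.
- by rewrite /= lebesgue_measure_itv /=; case: ifP => // _; rewrite -EFinB ltry.
- exact: measurable_funTS.
- exists K; split; first exact: num_real.
  by move=> L KL x _; exact/(le_trans (gK x))/ltW.
Qed.

(** The outer states of the reference solution and of the fan are the same
    Riemann data, so the two profiles cancel for large |xi|. *)
Lemma integrable_Lambda_gap (R : realType) (p e : R -> R) (d : riemann_data R)
    (N : nat) (F : fan R N) (M : nat) (S : selfsimilar R M) :
  admissible_fan_subsolution p e d F -> reference_solution p d S ->
  (@lebesgue_measure R).-integrable setT
    (fun xi => (Lambda_ref e S xi - Lambda_fan e d F xi)%:E).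
Proof.
move=> fanF refS.
have [A refA] := ref_profile_left (ref_sigma_lt refS)
  (fun j => lagrangian e (ref_state_rho S j) (normsq (ref_state_v S j)))
  (ref_sigma_first refS).
have [B refB] := ref_profile_right (ref_sigma_lt refS)
  (fun j => lagrangian e (ref_state_rho S j) (normsq (ref_state_v S j)))
  (ref_sigma_last refS).
have [K1 leK1] := ref_profile_bounded S
  (fun j => lagrangian e (ref_state_rho S j) (normsq (ref_state_v S j))).
have [K2 leK2] := fan_profile_bounded F
  (lagrangian e (rho_minus d) (normsq (v_minus d)))
  (fun i => lagrangian e (fan_rho F i) (fan_C F i))
  (lagrangian e (rho_plus d) (normsq (v_plus d))).
have nu0N : nu F ord0 <= nu F ord_max.
  have [N0|N0] := posnP N; last exact/ltW/(fan_nu_lt fanF).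
  by rewrite (_ : ord_max = ord0)//; apply/val_inj.
have [[rm vm] [rp vp]] := (ref_minus refS, ref_plus refS).
apply: (@compact_support_integrable _ _ (Num.min A (nu F ord0))
  (Num.max B (nu F ord_max)) (K1 + K2)).
- apply: measurable_funB; first exact: measurable_ref_profile.
  exact: measurable_fan_profile.
- move=> xi; apply: (le_trans (ler_normB _ _)).
  by apply: lerD; [exact: leK1 | exact: leK2].
- move=> xi; rewrite lt_min => /andP[xiA xinu].
  by rewrite /Lambda_ref refA// rm vm /Lambda_fan /fan_profile xinu subrr.
- move=> xi; rewrite gt_max => /andP[xiB xinu].
  by rewrite /Lambda_ref refB// rp vp /Lambda_fan fan_profile_right// subrr.
Qed.

(** * The Lagrangian density of a realization *)

(** Oscillations of v are invisible to the Lagrangian density, which depends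
    on v through |v|^2 only. The rays x2 = nu_k * t belong to no sector and
    are left out, since the value of the profile there is a convention. *)
Lemma ae_lagrangian_realization (R : realType) (p e : R -> R)
    (d : riemann_data R) (N : nat) (F : fan R N)
    (rho : spacetime R -> R) (v : spacetime R -> 'rV[R]_2) :
  convex_integration_realization p e d F rho v ->
  {ae leb3 R, forall z, 0 < z.1 -> (forall k, z.2.2 <> nu F k * z.1) ->
    lagrangian e (rho z) (normsq (v z)) = Lambda_fan e d F (z.2.2 / z.1)}.
Proof.
move=> [_ rhoE vm vp vmid].
have {}vmid : {ae leb3 R, forall z, forall i,
    P_mid F i z -> normsq (v z) = fan_C F i}.
  exact: filter_forall.
have aeF := ae_filter_ringOfSetsType (leb3 R).
apply: (@filterS2 _ _ aeF _ _ _ _ (@filterI _ _ aeF _ _ rhoE vm)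
  (@filterI _ _ aeF _ _ vp vmid)).
move=> z [{}rhoE {}vm] [{}vp {}vmid] z0 znu.
rewrite rhoE// /rho_bar /Lambda_fan /fan_field.
have lt_slope c : (c < z.2.2 / z.1) = (c * z.1 < z.2.2) by rewrite ltr_pdivlMr.
have slope_lt c : (z.2.2 / z.1 < c) = (z.2.2 < c * z.1) by rewrite ltr_pdivrMr.
have [xi0|xi0] := ltP (z.2.2 / z.1) (nu F ord0).
  by rewrite /fan_profile xi0 vm//; split=> //; rewrite -slope_lt.
have [xiN|xiN] := ltP (nu F ord_max) (z.2.2 / z.1).
  rewrite /fan_profile ltNge xi0 xiN /= vp//; split=> //.
  by rewrite -lt_slope.
rewrite /fan_profile !ltNge xi0 xiN /=; case: pickP => [i|no_cell].
  rewrite lt_slope slope_lt => zi; rewrite (vmid i)//; by split.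
have [|k zk|i] := @fan_cell _ _ F (z.2.2 / z.1); first by rewrite xi0.
  by apply: (znu k); rewrite -zk divfK// gt_eqF.
by rewrite no_cell.
Qed.

Lemma ae_off_lines (R : realType) (I : finType) (c : I -> R) :
  {ae leb2 R, forall x, forall i, x.2 <> c i}.
Proof.
apply: filter_forall => i; exists ([set: R] `*` [set c i]); split.
- exact: measurableX.
- transitivity (@lebesgue_measure R setT * @lebesgue_measure R [set c i])%E.
    exact: product_measure1E.
  by rewrite lebesgue_measure_set1 mule0.
- by move=> [x y] /= /contrapT.
Qed.

(** * The action difference *)

Theorem theorem3p2 (R : realType) (p e : R -> R) (d : riemann_data R)
    (N : nat) (F : fan R N)
    (rho : spacetime R -> R) (v : spacetime R -> 'rV[R]_2)
    (M : nat) (S : selfsimilar R M) :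
  pressure_law p e ->
  0 < rho_minus d -> 0 < rho_plus d ->
  admissible_fan_subsolution p e d F ->
  convex_integration_realization p e d F rho v ->
  reference_solution p d S ->
  forall l t : R, 0 < l -> 0 < t ->
    [/\ action_difference e l (rho_ref S) (v_ref S) rho v t
          = (l * t ^+ 2 / 2 * action_gap e d F S)%:E,
        (0 < action_difference e l (rho_ref S) (v_ref S) rho v t)%E
          <-> 0 < action_gap e d F S
      & (action_difference e l (rho_ref S) (v_ref S) rho v t < 0)%E
          <-> action_gap e d F S < 0].
Proof.
move=> _ _ _ fanF cirF refS l t l0 t0.
suff gapE : action_difference e l (rho_ref S) (v_ref S) rho v t
          = (l * t ^+ 2 / 2 * action_gap e d F S)%:E.
  have c0 : 0 < l * t ^+ 2 / 2 by rewrite !mulr_gt0 ?exprn_gt0 ?invr_gt0.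
  by rewrite gapE lte_fin lte_fin pmulr_rgt0// pmulr_rlt0.
set D := action_gap e d F S.
rewrite (_ : l * t ^+ 2 / 2 * D = l * D * t ^+ 2 / 2); last first.
  by rewrite mulrAC [l * t ^+ 2 * D]mulrAC.
rewrite -integral_linear// /action_difference; apply: eq_integral_ae.
have s_neq0 : {ae @lebesgue_measure R, forall s : R, s <> 0}.
  exists [set 0]; split => //; first exact: lebesgue_measure_set1.
  by move=> s /= /contrapT.
have := ae_product_slice (ae_lagrangian_realization cirF).
apply: (@filterS2 _ _ (ae_filter_ringOfSetsType (@lebesgue_measure R))
  _ _ _ _ s_neq0) => s /eqP {}s_neq0 fan_slice /=.
rewrite in_itv /= => /andP[s_ge0 _].
have s0 : 0 < s by rewrite lt_neqAle eq_sym s_neq0.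
transitivity (\int[leb2 R]_(x in `[0%R, l[ `*` setT)
   (Lambda_ref e S (x.2 / s) - Lambda_fan e d F (x.2 / s))%:E)%E.
  apply: eq_integral_ae.
  apply: (@filterS2 _ _ (ae_filter_ringOfSetsType (leb2 R)) _ _ _ _
    (ae_off_lines (fun k => nu F k * s)) fan_slice).
  move=> x x_off fan_x _; rewrite fan_x//; congr (_ - _)%:E.
  by rewrite /Lambda_ref /rho_ref /v_ref /ref_profile; case: pickP.
rewrite (integral_strip l0 s0 (integrable_Lambda_gap fanF refS)).
by rewrite mulrAC.
Qed.
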